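(* When $A$ is infinite, coordinatewise pairwise compactness need not imply pairwise soft compactness, even for canonical soft bitopologies and even for compact Hausdorff coordinate groups. That is, for every infinite set $A$ there exist a group $G$, a soft group $F:A\to\mathcal P(G)$ and canonical soft topologies $\tau_1,\tau_2$ on $F$ such that for every $t\in A$ and $i\in\{1,2\}$ the group $(F(t),(\tau_i)_t)$ is a compact Hausdorff topological group and $F(t)$ is pairwise compact in $(F(t),(\tau_1)_t,(\tau_2)_t)$, but $(F,\tau_1,\tau_2)$ is not pairwise soft compact.
   Context: A soft set over $G$ with parameter set $A$ is a map $F:A\to\mathcal P(G)$; it is a soft group if every $F(t)$ is a subgroup of $G$. $\mathrm{SE}(F)=\prod_{t\in A}F(t)$. A soft subset of $F$ is a map $H:A\to\mathcal P(G)$ with $H(t)\subseteq F(t)$ for all $t$; soft unions and intersections are parameterwise. A soft topology $\tau$ on $F$ is a family of soft subsets of $F$ containing $F$ and the empty soft set (all sections empty), closed under arbitrary soft unions and finite soft intersections. Component topology: $\tau_t=\{H(t):H\in\tau\}$ on $F(t)$. $\tau$ is canonical if it consists of all soft subsets $H$ of $F$ with $H(t)\in\tau_t$ for all $t$. The selector (box) topology $\tau^\ast$ on $\mathrm{SE}(F)$ has base $\{\prod_{t\in A}U_t:U_t\in\tau_t\ \forall t\}$. For topologies $\alpha,\beta$ on a set, $\alpha\vee\beta$ is the topology generated by $\alpha\cup\beta$. A subset of a bitopological space $(Y,\alpha,\beta)$ is pairwise compact if it is compact as a subspace of $(Y,\alpha\vee\beta)$. $(F,\tau_1,\tau_2)$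 is pairwise soft compact if $\mathrm{SE}(F)$ is compact in $(\tau_1)^\ast\vee(\tau_2)^\ast$. *)

(* Defs.v *)
From HB Require Import structures.
From mathcomp Require Import all_boot monoid.
From mathcomp Require Import boolp classical_sets functions cardinality.
From mathcomp Require Import topology.

Set Implicit Arguments.
Unset Strict Implicit.
Unset Printing Implicit Defensive.

Local Open Scope classical_set_scope.

(* Soft sets have sections that are subsets of one ambient group, so a topology
   on a set K is kept as a family of subsets of the ambient type contained
   in K. *)
Record is_topology (T : Type) (K : set T) (tau : set (set T)) : Prop := {
  topo_sub : forall U, tau U -> U `<=` K;
  topo_full : tau K;
  topo_empty : tau set0;
  topo_bigcup : forall C : set (set T), C `<=` tau -> tau (\bigcup_(U in C) U);
  topo_setI : forall U V, tau U -> tau V -> tau (U `&` V)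
}.

Record topology (T : Type) (K : set T) := Topology {
  opens :> set (set T);
  opensP : is_topology K opens
}.

(* The points of K (as a type) with the topology tau. *)
Definition space (T : choiceType) (K : set T) (tau : topology K) : Type :=
  set_type K.

Section SpaceTopology.
Context (T : choiceType) (K : set T) (tau : topology K).

Definition space_open : set_system (space tau) :=
  [set U | opens tau [set val x | x in (U : set (set_type K))]].

Let space_openT : space_open setT.
Proof.
rewrite /space_open /=; have -> : [set val x | x in [set: set_type K]] = K.
  apply/seteqP; split=> [_ [x _ <-]|x Kx]; first exact/set_mem/(valP x).
  by exists (SigSub (mem_set Kx)).
exact: (topo_full (opensP tau)).
Qed.

Let space_openI : setI_closed space_open.
Proof.
move=> U V oU oV; rewrite /space_open /=.
rewrite (_ : [set _ | _ in _] =
  [set val x | x in (U : set (set_type K))] `&`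
  [set val x | x in (V : set (set_type K))]).
  exact: (topo_setI (opensP tau) oU oV).
apply/seteqP; split=> [_ [x [Ux Vx] <-]|_ [[x Ux <-] [y Vy /val_inj yx]]].
  by split; exists x.
by exists x => //; split => //; rewrite -yx.
Qed.

Let space_open_bigU (I : Type) (f : I -> set (space tau)) :
  (forall i, space_open (f i)) -> space_open (\bigcup_i f i).
Proof.
move=> of_; rewrite /space_open /=.
pose im i := [set val x | x in (f i : set (set_type K))].
rewrite (_ : [set _ | _ in _] = \bigcup_(U in range im) U).
  by apply: (topo_bigcup (opensP tau)) => _ [i _ <-]; exact: of_.
apply/seteqP; split=> [_ [x [i _ fix_] <-]|_ [_ [i _ <-] [x fix_ <-]]].
  by exists (im i); [exists i | exists x].
by exists x => //; exists i.
Qed.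

HB.instance Definition _ := Choice.copy (space tau) (set_type K).
HB.instance Definition _ :=
  isOpenTopological.Build (space tau) space_openT space_openI space_open_bigU.

End SpaceTopology.

Section Join.
Context (T : Type) (K : set T) (alpha beta : topology K).

Let joinP : is_topology K (smallest (is_topology K) (alpha `|` beta)).
Proof.
have subsetsP : is_topology K [set V | V `<=` K].
  split=> [V //|//|x []|C Csub|V W VK _ x [/VK]//].
  exact: bigcup_sub.
split.
- move=> U sU; apply: (sU [set V | V `<=` K]); split=> // V [oV|oV].
    exact: (topo_sub (opensP alpha) oV).
  exact: (topo_sub (opensP beta) oV).
- by move=> M [MP _]; exact: (topo_full MP).
- by move=> M [MP _]; exact: (topo_empty MP).
- by move=> C Csub M [MP sM]; apply: (topo_bigcup MP) => U /Csub sU;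
  exact: sU.
- by move=> U V sU sV M [MP sM]; apply: (topo_setI MP);
  [exact: sU|exact: sV].
Qed.

Definition join_topology : topology K := Topology joinP.

End Join.

Definition pairwise_compact (T : choiceType) (K : set T)
    (alpha beta : topology K) (B : set (set_type K)) : Prop :=
  compact (B : set (space (join_topology alpha beta))).

Notation soft_set A G := (A -> set G).

Definition soft_subset (A G : Type) (H F : soft_set A G) : Prop :=
  forall t, H t `<=` F t.

Record is_soft_topology (A G : Type) (F : soft_set A G)
    (tau : set (soft_set A G)) : Prop := {
  soft_topo_sub : forall H, tau H -> soft_subset H F;
  soft_topo_full : tau F;
  soft_topo_empty : tau (fun=> set0);
  soft_topo_bigcup : forall C : set (soft_set A G),
    C `<=` tau -> tau (fun t => \bigcup_(H in C) H t);
  soft_topo_setI : forall H1 H2, tau H1 -> tau H2 ->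
    tau (fun t => H1 t `&` H2 t)
}.

Record soft_topology (A G : Type) (F : soft_set A G) := SoftTopology {
  soft_opens :> set (soft_set A G);
  soft_opensP : is_soft_topology F soft_opens
}.

Section Component.
Context (A G : Type) (F : soft_set A G) (tau : soft_topology F) (t : A).

Let componentP : is_topology (F t) [set H t | H in soft_opens tau].
Proof.
have tauP := soft_opensP tau; split.
- by move=> _ [H tauH <-]; apply: (soft_topo_sub tauP tauH).
- by exists F => //; exact: (soft_topo_full tauP).
- by exists (fun=> set0) => //; exact: (soft_topo_empty tauP).
- move=> C Csub; pose D := [set H | soft_opens tau H /\ C (H t)].
  exists (fun s => \bigcup_(H in D) H s).
    by apply: (soft_topo_bigcup tauP) => H [].
  apply/seteqP; split=> [x [H [_ CH] Hx]|x [U CU Ux]]; first by exists (H t).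
  by have [H tauH HU] := Csub _ CU; exists H; rewrite /D /= HU.
- move=> _ _ [H1 tauH1 <-] [H2 tauH2 <-]; exists (fun s => H1 s `&` H2 s) => //.
  exact: (soft_topo_setI tauP tauH1 tauH2).
Qed.

Definition component : topology (F t) := Topology componentP.

End Component.

Definition canonical_soft_topology (A G : Type) (F : soft_set A G)
    (tau : soft_topology F) : Prop :=
  forall H : soft_set A G,
    soft_opens tau H <-> soft_subset H F /\ forall t, opens (component tau t) (H t).

Definition soft_prod (A G : Type) (U : soft_set A G) : set (A -> G) :=
  [set f | forall t, U t (f t)].

Definition SE (A G : Type) (F : soft_set A G) : set (A -> G) := soft_prod F.

Section Selector.
Context (A G : Type) (F : soft_set A G) (tau : soft_topology F).

Definition box_base : set (set (A -> G)) :=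
  [set soft_prod U | U in [set U | forall t, opens (component tau t) (U t)]].

Let selectorP : is_topology (SE F)
  [set \bigcup_(B in C) B | C in [set C | C `<=` box_base]].
Proof.
have cP t := opensP (component tau t).
split.
- move=> _ [C CB <-] f [B /CB [U UP <-] Uf] t.
  exact: (topo_sub (cP t) (UP t)).
- exists [set SE F]; last by rewrite bigcup_set1.
  by move=> _ ->; exists F => // t; exact: (topo_full (cP t)).
- by exists set0; [exact: sub0set | rewrite bigcup_set0].
- move=> D Dsub.
  exists [set B | box_base B /\ exists2 W, D W & B `<=` W]; first by move=> B [].
  apply/seteqP; split=> [f [B [_ [W DW BW]] /BW Wf]|f [W DW Wf]].
    by exists W.
  have [C CB CW] := Dsub _ DW; move: Wf; rewrite -CW => -[B CB' Bf].
  exists B => //; split; first exact: CB.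
  by exists W => // g Bg; rewrite -CW; exists B.
- move=> _ _ [C CB <-] [D DB <-].
  exists [set B | box_base B /\
    B `<=` (\bigcup_(B in C) B) `&` (\bigcup_(B in D) B)]; first by move=> B [].
  apply/seteqP; split=> [f [B [_ BW] /BW]//|f [[B CB' Bf] [B' DB' B'f]]].
  have [U UP UB] := CB _ CB'; have [V VP VB] := DB _ DB'; subst B B'.
  exists (soft_prod (fun t => U t `&` V t)); last by move=> t; split.
  split; first by exists (fun t => U t `&` V t) => // t; apply: (topo_setI (cP t)).
  move=> g gUV; split; [exists (soft_prod U)|exists (soft_prod V)] => // t;
    by case: (gUV t).
Qed.

Definition selector_topology : topology (SE F) := Topology selectorP.

End Selector.

Definition pairwise_soft_compact (A : Type) (G : choiceType)
    (F : soft_set A G) (tau1 tau2 : soft_topology F) : Prop :=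
  compact [set: space (join_topology (selector_topology tau1)
                                     (selector_topology tau2))].

Record soft_group (A : Type) (G : groupType) := SoftGroup {
  sections :> soft_set A G;
  sectionsP : forall t, group_closed (mem (sections t))
}.

(* F(t) with the group structure inherited from G. *)
Definition section_group (A : Type) (G : groupType) (F : soft_group A G)
  (t : A) : Type := set_type (F t).

Section SectionGroup.
Context (A : Type) (G : groupType) (F : soft_group A G) (t : A).
HB.instance Definition _ := SubChoice.copy (section_group F t) (set_type (F t)).
HB.instance Definition _ :=
  SubChoice_isSubGroup.Build G (mem (F t)) (section_group F t) (sectionsP F t).
End SectionGroup.

Definition topological_group (A : Type) (G : groupType) (F : soft_group A G)
    (t : A) (tau : topology (F t)) : Prop :=
  continuous (fun z : space tau * space tau =>
    ((z.1 : section_group F t) * (z.2 : section_group F t))%g : space tau) /\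
  continuous (fun x : space tau =>
    ((x : section_group F t)^-1)%g : space tau).

Definition compact_hausdorff_group (A : Type) (G : groupType)
    (F : soft_group A G) (t : A) (tau : topology (F t)) : Prop :=
  [/\ topological_group tau, compact [set: space tau] &
      hausdorff_space (space tau)].

(* Main.v *)
Require Import Defs.
From HB Require Import structures.
From mathcomp Require Import all_boot monoid.
From mathcomp Require Import boolp classical_sets functions cardinality.
From mathcomp Require Import topology.
From mathcomp Require Import fingroup perm.

Set Implicit Arguments.
Unset Strict Implicit.
Unset Printing Implicit Defensive.

Local Open Scope classical_set_scope.

(* Take the same finite group with at least two elements at every parameter,
   and let both soft topologies consist of all soft subsets.  Every section is
   then a finite discrete group.  Since a box whose sides are singletons is a
   singleton, the selector topology is discrete as well, but on an infinite
   set. *)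

Lemma discrete_compactP (X : discreteTopologicalType) (K : set X) :
  compact K <-> finite_set K.
Proof.
split=> [cK|/finite_compact//]; have [->//|/set0P[x0 _]] := eqVneq K set0.
pose X0 : ptopologicalType := HB.pack X (isPointed.Build X x0).
have : @cover_compact X0 K by rewrite -compact_cover.
move=> /(_ X K set1)[x _|x Kx|D _ KD]; [exact: discrete_open|by exists x|].
by apply: (sub_finite_set _ (finite_fset D)) => x /KD [y Dy ->].
Qed.

Lemma discrete_continuous (X : discreteTopologicalType) (Y : topologicalType)
  (f : X -> Y) : continuous f.
Proof.
move=> x U /nbhs_singleton Ufx.
by rewrite nbhs_principalE; exact/principal_filterP.
Qed.

Lemma discrete_continuous2 (X Y : discreteTopologicalType)
  (Z : topologicalType) (f : X * Y -> Z) : continuous f.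
Proof.
move=> [x y] U /nbhs_singleton Ufxy.
exists ([set x], [set y]); first by split; exact: discrete_set1.
by move=> [_ _] [/= -> ->].
Qed.

Lemma opens_inj (T : Type) (K : set T) : injective (@opens T K).
Proof.
move=> [alpha alphaP] [beta betaP] /= eq_opens; rewrite eq_opens in alphaP *.
by rewrite (Prop_irrelevance alphaP betaP).
Qed.

Lemma join_topologyxx (T : Type) (K : set T) (tau : topology K) :
  join_topology tau tau = tau.
Proof.
apply: opens_inj; rewrite /= setUid smallest_id//.
exact: opensP.
Qed.

Lemma subsets_is_topology (T : Type) (K : set T) :
  is_topology K [set U | U `<=` K].
Proof.
split=> [//|//|x []//|C CK|U V UK _ x [/UK]//].
exact: bigcup_sub.
Qed.

Definition discrete_on (T : Type) (K : set T) : topology K :=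
  Topology (subsets_is_topology K).

Lemma space_openE (T : choiceType) (K : set T) (tau : topology K)
    (U : set (space tau)) :
  open U = opens tau [set val x | x in (U : set (set_type K))].
Proof. by []. Qed.

Lemma discrete_on_nbhsE (T : choiceType) (K : set T) :
  @nbhs _ (space (discrete_on K)) = principal_filter.
Proof.
apply/funext => x; apply/seteqP; split=> U.
  by move/nbhs_singleton => Ux; exact/principal_filterP.
move=> /principal_filterP Ux; apply: open_nbhs_nbhs; split=> //.
by rewrite space_openE => _ [y _ <-]; exact/set_mem/(valP y).
Qed.

HB.instance Definition _ (T : choiceType) (K : set T) :=
  Discrete_ofNbhs.Build (space (discrete_on K)) (@discrete_on_nbhsE T K).

Lemma discrete_on_compactP (T : choiceType) (K : set T) :
  compact [set: space (discrete_on K)] <-> finite_set K.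
Proof. by rewrite discrete_compactP (eq_finite_set (card_setT K)). Qed.

Lemma soft_prod_set1 (A G : Type) (f : A -> G) :
  soft_prod (fun t => [set f t]) = [set f].
Proof. by apply/seteqP; split=> [g gf|_ -> //]; exact/funext. Qed.

Lemma infinite_soft_prod (A G : Type) (F : soft_set A G) (f g : A -> G) :
  soft_prod F f -> soft_prod F g -> (forall t, f t <> g t) ->
  infinite_set [set: A] -> infinite_set (soft_prod F).
Proof.
move=> Ff Fg fg; apply: contra_not => finF.
pose switch_at a t := if `[< t = a >] then f t else g t.
have switch_inj : {in switch_at @^-1` soft_prod F &, injective switch_at}.
  move=> a b _ _ /(congr1 (@^~ a)); rewrite /switch_at asboolT//.
  by case: asboolP => // _ /fg.
apply: sub_finite_set (finite_preimage switch_inj finF) => a _ t.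
by rewrite /switch_at; case: ifP.
Qed.

Lemma soft_subsets_is_soft_topology (A G : Type) (F : soft_set A G) :
  is_soft_topology F [set H | soft_subset H F].
Proof.
split=> [//|t x //|t x []//|C CF t|H1 H2 H1F _ t x [/H1F]//].
by move=> x [H /CF HF]; exact: HF.
Qed.

Definition discrete_soft_topology (A G : Type) (F : soft_set A G) :
  soft_topology F := SoftTopology (soft_subsets_is_soft_topology F).

Section DiscreteSoftTopology.
Variables (A G : Type) (F : soft_set A G).

Lemma component_discrete (t : A) :
  component (discrete_soft_topology F) t = discrete_on (F t).
Proof.
apply: opens_inj; apply/seteqP; split=> [_ [H HF <-]|U UF].
  exact: HF.
exists (fun s => [set x | F s x /\ (s = t -> U x)]); first by move=> s x [].
by apply/seteqP; split=> [x [_]|x Ux]; [exact|split=> //; exact: UF].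
Qed.

Lemma discrete_soft_topology_canonical :
  canonical_soft_topology (discrete_soft_topology F).
Proof.
move=> H; split=> [HF|[]//]; split=> // t.
by rewrite component_discrete; exact: HF.
Qed.

Lemma selector_topology_discrete :
  selector_topology (discrete_soft_topology F) = discrete_on (SE F).
Proof.
apply: opens_inj; apply/seteqP; split=> U.
  exact: topo_sub (opensP (selector_topology _)) _.
move=> UF; exists (set1 @` U); last first.
  by rewrite bigcup_image bigcup_imset1 image_id.
move=> _ [f Uf <-]; rewrite -soft_prod_set1.
exists (fun t => [set f t]) => // t.
by rewrite component_discrete => _ ->; exact: UF.
Qed.

End DiscreteSoftTopology.

Lemma discrete_on_pairwise_compactP (T : choiceType) (K : set T) :
  pairwise_compact (discrete_on K) (discrete_on K) setT <-> finite_set K.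
Proof. by rewrite /pairwise_compact join_topologyxx discrete_on_compactP. Qed.

Lemma discrete_pairwise_soft_compactP (A : Type) (G : choiceType)
    (F : soft_set A G) :
  pairwise_soft_compact (discrete_soft_topology F) (discrete_soft_topology F)
  <-> finite_set (SE F).
Proof.
rewrite /pairwise_soft_compact join_topologyxx selector_topology_discrete.
exact: discrete_on_compactP.
Qed.

Lemma discrete_compact_hausdorff_group (A : Type) (G : groupType)
    (F : soft_group A G) (t : A) :
  finite_set (F t) -> compact_hausdorff_group (discrete_on (F t)).
Proof.
move=> finF; split; last exact: discrete_hausdorff.
- by split; [exact: discrete_continuous2 | exact: discrete_continuous].
- exact/discrete_on_compactP.
Qed.

Lemma group_closed_setT (G : groupType) : group_closed (mem [set: G]).
Proof. by split=> [|x y _ _]; exact/mem_set. Qed.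

Definition full_soft_group (A : Type) (G : groupType) : soft_group A G :=
  SoftGroup (fun _ : A => @group_closed_setT G).

Theorem proposition6p4 (A : Type) (A_infinite : infinite_set [set: A]) :
  exists (G : groupType) (F : soft_group A G) (tau1 tau2 : soft_topology F),
    [/\ canonical_soft_topology tau1,
        canonical_soft_topology tau2,
        forall t : A,
          [/\ compact_hausdorff_group (component tau1 t),
              compact_hausdorff_group (component tau2 t) &
              pairwise_compact (component tau1 t) (component tau2 t) setT] &
        ~ pairwise_soft_compact tau1 tau2].
Proof.
pose G : finGroupType := {perm bool}; pose F := full_soft_group A G.
have finF t : finite_set (F t) by exact: (@finite_finset G).
pose tau := discrete_soft_topology F.
have tau_canonical : canonical_soft_topology tau.
  exact: discrete_soft_topology_canonical.
exists G, F, tau, tau; split=> //.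
- move=> t; rewrite component_discrete.
  have cF := discrete_compact_hausdorff_group (finF t).
  by split=> //; exact/discrete_on_pairwise_compactP.
- move/discrete_pairwise_soft_compactP.
  pose swap (_ : A) : G := tperm true false.
  apply: (infinite_soft_prod (f := swap) (g := fun=> 1%g)) => // t.
  by move/permP/(_ true); rewrite perm1 tpermL.
Qed.
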